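(* Consider an instance of the energy-constrained scheduling problem with zero communication delays (defined in the context) with an arbitrary number $m \ge 1$ of processors. Let $\mu^*$ be the infimum of the makespans of feasible schedules on $m$ processors (preemption and migration allowed). Let $(\mu_1, (t_j), (d_j))$ be an optimal solution of program $P_1$, and let $\sigma_2$ be the schedule obtained from the durations $d_j$ by the following list-scheduling procedure: while some task is unscheduled, let $t$ be the earliest time for which there exist both a processor $p$ on which all already-scheduled tasks finish by time $t$ and an unscheduled task $j$ all of whose predecessors have been scheduled and complete by time $t$; schedule $j$ on $p$ over $[t, t+d_j]$. Then $\sigma_2$ is a feasible schedule on $m$ processors (using no preemption or migration) whose makespan is at most $(2 - 1/m)\,\mu^*$.
   Context: Problem (zero communication delays): we are given a finite set $J$ of $n$ tasks; $m$ identical processors; a directed acyclic graph $G$ on vertex set $J$ (an edge $i \to j$ means task $i$ must finish before task $j$ begins); for each task $j$ a convex, non-increasing energy function $e_j : [0,\infty) \to [0,\infty)$, where $e_j(d_j)$ is the energy consumed when $j$ runs for a total time $d_j$; and an energy bound $E \ge 0$. A schedule assigns to each task $j$ a finite set of time intervals, each on some processor (no task is computed more than once). $d_j$ denotes the total length of $j$'s intervals. The schedule is feasible if (a) for every edge $i \to j$, task $i$ has finished by the time $j$ begins; (b) each processor works on at most one task at any time; (c) $\sum_j e_j(d_j) \le E$. The makespan is the time at which the last task completes. Program $P_1$ (for given $m$): minimize $\mu$ over variables $\mu \ge 0$, $t_j \ge 0$, $d_j \ge 0$ ($j\in J$) subject to: $t_j \ge t_i + d_i$ for every edge $i \to j$;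 $\mu \ge t_j + d_j$ for all $j$; $\sum_j e_j(d_j) \le E$; $\mu \ge \frac{1}{m}\sum_j d_j$. *)

(* Defs.v *)
From HB Require Import structures.
From mathcomp Require Import all_boot all_order all_algebra finmap.
From mathcomp Require Import all_classical all_reals convex.

Set Implicit Arguments.
Unset Strict Implicit.
Unset Printing Implicit Defensive.

Import Order.TTheory GRing.Theory Num.Theory.

Local Open Scope classical_set_scope.
Local Open Scope fset_scope.
Local Open Scope ring_scope.

Definition acyclic (J : finType) (G : rel J) : Prop :=
  forall c : seq J, cycle G c -> c = [::].

(* Only the restriction of [f] to [0, +oo[ is meaningful. *)
Definition energy_function (R : realType) (f : R -> R) : Prop :=
  [/\ forall x, 0 <= x -> 0 <= f x,
      {in `[0, +oo[ &, {homo f : x y / x <= y >-> y <= x}}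
    & @convex_function R R^o `[0, +oo[%classic f].

Section Schedules.

Variables (R : realType) (J : finType) (m : nat).

(* The slot (p, a, b) is the time interval [a, b] on processor p. Slots of
   length 0 are allowed: they time the start and end of a task of duration 0. *)
Definition slot : Type := ('I_m * R * R)%type.

Definition proc (x : slot) : 'I_m := x.1.1.
Definition start (x : slot) : R := x.1.2.
Definition stop (x : slot) : R := x.2.

Definition schedule : Type := {ffun J -> {fset slot}}.

Implicit Types (S : schedule) (G : rel J) (e : J -> R -> R) (E : R).

Definition duration S (j : J) : R := \sum_(x <- S j) (stop x - start x).

Definition makespan S : R :=
  \big[Num.max/0]_(j : J) \big[Num.max/0]_(x <- S j) stop x.

Definition nonoverlapping (x y : slot) : Prop :=
  stop x <= start y \/ stop y <= start x.

(* Every task is given at least one slot (possibly of length 0), so that its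
   beginning and its end are defined; otherwise a task of duration 0 would not
   transmit precedence from its predecessors to its successors. *)
Definition well_formed S : Prop :=
  forall j, S j <> fset0 /\ forall x, x \in S j -> 0 <= start x <= stop x.

(* A task may be preempted and may migrate, but it never runs on two processors
   at the same time and no part of it is computed twice. *)
Definition no_parallel_execution S : Prop :=
  forall j x y, x \in S j -> y \in S j -> x <> y -> nonoverlapping x y.

Definition respects_precedence G S : Prop :=
  forall i j x y, G i j -> x \in S i -> y \in S j -> stop x <= start y.

Definition respects_processors S : Prop :=
  forall i j x y, i <> j -> x \in S i -> y \in S j -> proc x = proc y ->
    nonoverlapping x y.

Definition feasible G e E S : Prop :=
  [/\ well_formed S /\ no_parallel_execution S, respects_precedence G S,
      respects_processors S & \sum_(j : J) e j (duration S j) <= E].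

Definition no_preemption_or_migration S : Prop :=
  forall j, exists x, S j = [fset x].

Definition optimal_makespan G e E : R :=
  inf [set makespan S | S in feasible G e E].

Definition P1_feasible G e E (mu : R) (t d : J -> R) : Prop :=
  [/\ [/\ 0 <= mu, forall j, 0 <= t j & forall j, 0 <= d j],
      forall i j, G i j -> t i + d i <= t j,
      forall j, t j + d j <= mu,
      \sum_(j : J) e j (d j) <= E
    & m%:R^-1 * \sum_(j : J) d j <= mu].

Definition P1_optimal G e E (mu : R) (t d : J -> R) : Prop :=
  P1_feasible G e E mu t d /\
  forall mu' t' d', P1_feasible G e E mu' t' d' -> mu <= mu'.

(* List scheduling: a state is a partial schedule, in which a task is
   unscheduled when its set of slots is empty. Ties between processors and
   between tasks are broken arbitrarily, so the procedure is a relation. *)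
Definition scheduled S (j : J) : bool := S j != fset0.

Definition completed_by S (t : R) (j : J) : Prop :=
  forall x, x \in S j -> stop x <= t.

Definition available S (t : R) (p : 'I_m) : Prop :=
  forall j x, x \in S j -> proc x = p -> stop x <= t.

Definition ready G S (t : R) (j : J) : Prop :=
  ~~ scheduled S j /\ forall i, G i j -> scheduled S i /\ completed_by S t i.

Definition can_start G S (t : R) (p : 'I_m) (j : J) : Prop :=
  [/\ 0 <= t, available S t p & ready G S t j].

Definition list_step G (d : J -> R) S S' : Prop :=
  exists t p j,
    [/\ can_start G S t p j,
        forall t' p' j', can_start G S t' p' j' -> t <= t'
      & S' = [ffun k => if k == j then [fset (p, t, t + d j)] else S k]].

Inductive list_reachable G (d : J -> R) : schedule -> Prop :=
| list_init : list_reachable G d [ffun=> fset0]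
| list_next S S' :
    list_reachable G d S -> list_step G d S S' -> list_reachable G d S'.

Definition list_schedule G (d : J -> R) S : Prop :=
  list_reachable G d S /\ forall j, scheduled S j.

End Schedules.

(* Main.v *)
(* Turning any feasible, possibly preemptive, schedule into starting times (the
   first start of each task) and total durations gives a feasible point of [P_1],
   so its optimum [mu1] is at most the optimal makespan. For the list schedule
   with durations [d], consider the total idle time of the [m] processors before
   a time [v]. No processor is idle between the moment a task becomes ready and
   its start, and at most [m - 1] processors are idle while a task runs; going
   back from a task to its last-finishing predecessor, the idle time before the
   start of [j] is therefore at most [(m - 1) * t j]. If [c] is the makespan,
   [m * c] is the total work plus the idle time before [c], hence at most
   [m * mu1 + (m - 1) * mu1]. *)
Require Import Defs.
From HB Require Import structures.
From mathcomp Require Import all_boot all_order all_algebra finmap.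
From mathcomp Require Import all_classical all_reals convex.
From mathcomp Require Import lra.

Set Implicit Arguments.
Unset Strict Implicit.
Unset Printing Implicit Defensive.

Import Order.TTheory GRing.Theory Num.Theory.

Local Open Scope ring_scope.

(** * Packing and covering of an interval by intervals *)

(** Strong induction on the number of intervals. The first one splits the others into those that
    stop by [a x], packed in [[lo, a x]], and the rest, which must start after [b x] and are packed
    in [[b x, hi]]. *)
Lemma interval_packing (R : realType) (I : eqType) (a b : I -> R) (s : seq I)
    (lo hi : R) :
  lo <= hi -> uniq s ->
  (forall x, x \in s -> [/\ lo <= a x, a x <= b x & b x <= hi]) ->
  (forall x y, x \in s -> y \in s -> x <> y -> b x <= a y \/ b y <= a x) ->
  \sum_(x <- s) (b x - a x) <= hi - lo.
Proof.
have [n] := ubnP (size s); elim: n s lo hi => // n IHn [|x s] lo hi /=.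
  by rewrite big_nil => _ le_lohi; rewrite subr_ge0.
rewrite ltnS => lt_sn le_lohi /andP[xNs uniq_s] s_in disj.
rewrite big_cons (bigID (fun y => b y <= a x)) /=.
rewrite -big_filter -[X in _ + (_ + X)]big_filter.
have [lo_a a_b b_hi] := s_in x (mem_head x s).
have filter_lt (Q : pred I) : (size [seq y <- s | Q y] < n)%N.
  by rewrite size_filter (leq_ltn_trans (count_size _ _)).
have disj_s y z : y \in s -> z \in s -> y <> z -> b y <= a z \/ b z <= a y.
  by move=> ys zs; apply: disj; rewrite inE (ys, zs) orbT.
have left_le : \sum_(y <- [seq y <- s | b y <= a x]) (b y - a y) <= a x - lo.
  apply: IHn => [||| y | y z]; rewrite ?filter_uniq ?mem_filter //.
    by case/andP=> ? ys; have [] := s_in y; rewrite ?inE ?ys ?orbT.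
  by move=> /andP[_ ys] /andP[_ zs]; apply: disj_s.
have right_le : \sum_(y <- [seq y <- s | ~~ (b y <= a x)]) (b y - a y)
    <= hi - b x.
  apply: IHn => [||| y | y z]; rewrite ?filter_uniq ?mem_filter //.
    case/andP=> b_a ys; have [] := s_in y; rewrite ?inE ?ys ?orbT // => ? ? ?.
    split=> //; have neq_xy : x <> y by move=> eq_xy; rewrite eq_xy ys in xNs.
    have ys' : y \in x :: s by rewrite inE ys orbT.
    have [//|le_b_a] := disj x y (mem_head x s) ys' neq_xy.
    by rewrite le_b_a in b_a.
  by move=> /andP[_ ys] /andP[_ zs]; apply: disj_s.
lra.
Qed.

(** For [a <= b], the length of the part of [[a, b]] that lies before [u]. *)
Definition elapsed {R : realType} (a b u : R) : R := Num.min b u - Num.min a u.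

Lemma elapsed_homo {R : realType} (a b u v : R) :
  a <= b -> u <= v -> elapsed a b u <= elapsed a b v.
Proof.
rewrite /elapsed /Num.min => ab uv.
by case: (ltP b u); case: (ltP a u); case: (ltP b v); case: (ltP a v); lra.
Qed.

Lemma elapsed_ge0 {R : realType} (a b u : R) : a <= b -> 0 <= elapsed a b u.
Proof.
by rewrite /elapsed /Num.min => ab; case: (ltP b u); case: (ltP a u); lra.
Qed.

Lemma elapsed_le {R : realType} (a b u : R) : a <= b -> elapsed a b u <= b - a.
Proof.
by rewrite /elapsed /Num.min => ab; case: (ltP b u); case: (ltP a u); lra.
Qed.

Lemma elapsed_start {R : realType} (a b : R) : a <= b -> elapsed a b a = 0.
Proof. by move=> ab; rewrite /elapsed (min_idPr ab) minxx subrr. Qed.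

Lemma elapsed_stop {R : realType} (a b : R) : a <= b -> elapsed a b b = b - a.
Proof. by move=> ab; rewrite /elapsed (min_idPl ab) minxx. Qed.

(** Induction on the number of intervals: one that covers [lo] accounts for the length from [lo] to
    its end, and the others must cover what lies beyond. Each summand is the length of [[a x, b x]]
    inside [[lo, hi]]. *)
Lemma interval_covering (R : realType) (I : eqType) (a b : I -> R) (s : seq I)
    (lo hi : R) :
  lo <= hi -> (forall x, x \in s -> a x <= b x) ->
  (forall u, lo <= u < hi -> exists2 x, x \in s & a x <= u < b x) ->
  hi - lo <= \sum_(x <- s) (elapsed (a x) (b x) hi - elapsed (a x) (b x) lo).
Proof.
have [n] := ubnP (size s); elim: n s lo => // n IHn s lo lt_sn lo_hi ab cover.
have [hi_lo|lt_lohi] := leP hi lo.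
  have -> : lo = hi by apply/le_anti/andP.
  by rewrite big1 => [|x _]; rewrite subrr.
have [|x xs /andP[a_lo lo_b]] := cover lo; first by rewrite lexx.
rewrite (big_rem _ xs) /=.
have rem_ab y : y \in rem x s -> a y <= b y by move/mem_rem; apply: ab.
(* Raising the lower end of the window only decreases the remaining terms, so a bound for the window
   from [b x] also serves for the one from [lo]. *)
have rem_ge (c : R) : lo <= c <= hi ->
    \sum_(y <- rem x s) (elapsed (a y) (b y) hi - elapsed (a y) (b y) c)
    <= \sum_(y <- rem x s) (elapsed (a y) (b y) hi - elapsed (a y) (b y) lo).
  move=> /andP[lo_c c_hi]; rewrite !(big_seq _ _ (rem x s)).
  apply: ler_sum => y /rem_ab yab.
  by rewrite lerD2l lerN2 elapsed_homo.
have [hi_b|b_hi] := leP hi (b x).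
  have := rem_ge hi; rewrite lo_hi lexx => /(_ isT).
  rewrite [X in X <= _ -> _]big1 => [|y _]; last by rewrite subrr.
  rewrite /elapsed (min_idPr hi_b) (min_idPr (ltW lo_b)) (min_idPl a_lo).
  by rewrite (min_idPl (le_trans a_lo lo_hi)); lra.
have := rem_ge (b x); rewrite (ltW lo_b) (ltW b_hi) => /(_ isT).
have cover_rem u : b x <= u < hi ->
    exists2 y, y \in rem x s & a y <= u < b y.
  move=> /andP[bu uhi]; have [|y ys yu] := cover u.
    by rewrite (le_trans (ltW lo_b) bu).
  exists y => //; have := perm_to_rem xs => /perm_mem/(_ y).
  rewrite ys inE => /esym/orP[/eqP yx|//].
  by move: yu; rewrite yx [u < _]ltNge bu andbF.
have size_lt : (size (rem x s) < n)%N.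
  by rewrite size_rem //; case: (s) xs lt_sn.
have := IHn _ (b x) size_lt (ltW b_hi) rem_ab cover_rem.
have -> : elapsed (a x) (b x) hi = b x - a x.
  by rewrite /elapsed (min_idPl (ltW b_hi)) (min_idPl (le_trans a_lo lo_hi)).
have -> : elapsed (a x) (b x) lo = lo - a x.
  by rewrite /elapsed (min_idPr (ltW lo_b)) (min_idPl a_lo).
lra.
Qed.

(** * From feasible schedules to feasible points of the program *)

(** Slots are tagged with their task: two tasks may share a slot of length 0, and the tags keep the
    sequence free of duplicates. *)
Definition slots {R : realType} {J : finType} {m : nat} (S : schedule R J m) :
    seq (J * slot R m) :=
  [seq (j, x) | j <- enum J, x <- enum_fset (S j)].

Section Slots.
Variables (R : realType) (J : finType) (m : nat).
Implicit Type S : schedule R J m.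

Lemma mem_slots S (y : J * slot R m) : (y \in slots S) = (y.2 \in S y.1).
Proof.
apply/allpairsPdep/idP => [[j [x [_ xS ->]]] //|yS].
by exists y.1, y.2; rewrite mem_enum; split=> //; case: y {yS}.
Qed.

Lemma uniq_slots S : uniq (slots S).
Proof.
apply: allpairs_uniq_dep => [|j _|]; rewrite ?enum_uniq ?fset_uniq //.
by move=> [i x] [j z] _ _ /= [-> ->].
Qed.

Lemma big_slots S (F : J * slot R m -> R) :
  \sum_(y <- slots S) F y = \sum_j \sum_(x <- S j) F (j, x).
Proof. by rewrite big_allpairs_dep big_enum. Qed.

Lemma stop_le_makespan S j x : x \in S j -> stop x <= makespan S.
Proof.
move=> xS; apply: le_trans (le_bigmax _ _ j); exact: (bigmax_sup_seq _ _ _ _ _ xS).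
Qed.

Lemma makespan_ge0 S : 0 <= makespan S.
Proof. exact: bigmax_ge_id. Qed.

Lemma feasible_P1 G e E S : (0 < m)%N -> feasible G e E S ->
  exists t, P1_feasible m G e E (makespan S) t (duration S).
Proof.
move=> m_gt0 [[wf nopar] prec procs energy].
have slot_ge0 j x : x \in S j -> 0 <= start x <= stop x by case: (wf j) => _; apply.
(* The default value is harmless: every task has a slot, and none starts after the makespan. *)
pose t j := \big[Num.min/makespan S]_(x <- S j) start x.
have t_ge c j : c <= makespan S -> (forall x, x \in S j -> c <= start x) ->
    c <= t j.
  by move=> c_le c_start; rewrite /t big_seq; apply: le_bigmin.
have t_le j x : x \in S j -> t j <= start x.
  by move=> xS; apply: (bigmin_inf_seq _ _ _ _ _ xS).
(* The slots of [j] do not overlap and are packed between [t j] and [hi]. *)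
have duration_le hi j : t j <= hi -> (forall x, x \in S j -> stop x <= hi) ->
    t j + duration S j <= hi.
  move=> t_hi stop_hi; rewrite -lerBrDl; apply: interval_packing => //.
  + move=> x xS; have /andP[_ ?] := slot_ge0 _ _ xS.
    by split; [exact: t_le| |exact: stop_hi].
  + exact: nopar.
exists t; split=> //.
- split=> [|j|j]; first exact: makespan_ge0.
    apply: t_ge => [|x /slot_ge0/andP[]//]; exact: makespan_ge0.
  rewrite /duration big_seq; apply: sumr_ge0 => x /slot_ge0/andP[_].
  by rewrite subr_ge0.
- move=> i j Gij; have [/eqP/fset0Pn[x xSi] _] := wf i.
  have stop_t y : y \in S i -> stop y <= t j.
    move=> ySi; apply: t_ge => [|z zSj]; first exact: stop_le_makespan ySi.
    exact: prec Gij ySi zSj.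
  apply: duration_le => //; apply: le_trans (t_le _ _ xSi) _.
  by apply: le_trans (stop_t _ xSi); have /andP[] := slot_ge0 _ _ xSi.
- move=> j; apply: duration_le => [|x xS]; first exact: bigmin_le_id.
  exact: stop_le_makespan xS.
(* Load constraint: the slots of each processor are packed between 0 and the makespan. *)
rewrite mulrC ler_pdivrMr ?ltr0n // -(big_slots S (fun y => stop y.2 - start y.2)).
rewrite (partition_big (fun y => proc y.2) xpredT) //=.
have -> : makespan S * m%:R = \sum_(p < m) (makespan S - 0).
  by rewrite sumr_const card_ord subr0 mulr_natr.
apply: ler_sum => p _; rewrite -big_filter.
apply: (@interval_packing R _ (fun y => start y.2) (fun y => stop y.2)).
- exact: makespan_ge0.
- by rewrite filter_uniq // uniq_slots.
- move=> y; rewrite mem_filter mem_slots => /andP[_ yS].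
  have /andP[? ?] := slot_ge0 _ _ yS.
  by split=> //; exact: stop_le_makespan yS.
move=> [i x] [j z]; rewrite !mem_filter !mem_slots /=.
move=> /andP[/eqP xp xS] /andP[/eqP zp zS] neq.
have [eq_ij|/eqP neq_ij] := eqVneq i j.
  subst j; apply: nopar xS zS _ => eq_xz; by rewrite eq_xz in neq.
by apply: procs neq_ij xS zS _; rewrite xp zp.
Qed.

(** The existence of a feasible schedule makes [optimal_makespan] the infimum of a nonempty set, so
    that a lower bound of the set bounds it. *)
Lemma P1_optimal_le G e E mu t d : (0 < m)%N -> P1_optimal m G e E mu t d ->
  (exists S, feasible G e E S) -> mu <= optimal_makespan m G e E.
Proof.
move=> m_gt0 [_ mu_min] [S feasS]; apply: lb_le_inf; first by exists (makespan S), S.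
move=> _ [S' /(feasible_P1 m_gt0)[t' feas'] <-]; exact: mu_min feas'.
Qed.

End Slots.

(** * Invariants of list scheduling *)

Section ListScheduling.
Variables (R : realType) (J : finType) (m : nat) (G : rel J) (d : J -> R).
Hypothesis d_ge0 : forall j, 0 <= d j.
Implicit Types (S : schedule R J m) (p : 'I_m) (j k : J).

Definition assign S (u : R) p j : schedule R J m :=
  [ffun k => if k == j then [fset (p, u, (u + d j)%R)]%fset else S k].

Definition earliest_start S (u : R) p j : Prop :=
  can_start G S u p j /\ forall u' p' j', can_start G S u' p' j' -> u <= u'.

(** Induction along a run of the procedure, with each step exposed as an [assign] at an earliest
    start. *)
Lemma reachable_ind (P : schedule R J m -> Prop) :
  P [ffun=> fset0] ->
  (forall S u p j, list_reachable G d S -> P S -> earliest_start S u p j ->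
     P (assign S u p j)) ->
  forall S, list_reachable G d S -> P S.
Proof.
move=> P0 PS S; elim=> // {}S S' reachS PS0 [u [p [j [start_j first_j ->]]]].
exact: PS.
Qed.

Lemma scheduledP S j : reflect (exists x, x \in S j) (scheduled S j).
Proof. exact: fset0Pn. Qed.

Lemma scheduled_assign S u p j k :
  scheduled (assign S u p j) k = (k == j) || scheduled S k.
Proof.
rewrite /scheduled ffunE; case: (eqVneq k j) => //= _.
by apply/fset0Pn; exists (p, u, u + d j); rewrite inE.
Qed.

Lemma mem_assign S u p j k x : ~~ scheduled S j ->
  x \in assign S u p j k <-> x \in S k \/ k = j /\ x = (p, u, u + d j).
Proof.
rewrite /scheduled negbK ffunE => /eqP Sj0.
case: (eqVneq k j) => [->|neq_kj]; last first.
  by split=> [|[//|[eq_kj _]]]; [left|rewrite eq_kj eqxx in neq_kj].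
by rewrite Sj0; split=> [/fset1P|[|[_ ->]]]; [right|rewrite inE|rewrite fset11].
Qed.

Lemma reachable_slot S j x : list_reachable G d S -> x \in S j ->
  [/\ S j = [fset x]%fset, 0 <= start x & stop x = start x + d j].
Proof.
move=> reachS; elim/reachable_ind: S / reachS j x => [j x|]; first by rewrite ffunE.
move=> S u p j reachS IH [[u_ge0 _ _] _] k x; rewrite ffunE.
case: eqP => [->|_]; last exact: IH.
by rewrite inE => /eqP ->.
Qed.

Lemma reachable_precedence S i j x : list_reachable G d S -> G i j ->
  x \in S j -> scheduled S i /\ completed_by S (start x) i.
Proof.
move=> reachS Gij; elim/reachable_ind: S / reachS x => [x|]; first by rewrite ffunE.
move=> S u p k _ IH [[_ _ [k_unsched preds]] _] x xS.
have [sched_i done_i] : scheduled S i /\ completed_by S (start x) i.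
  by case/mem_assign: xS => // [/IH|[eq_jk ->]] //; apply: preds; rewrite -eq_jk.
(* Since [i] was already scheduled, the assignment gives it no new slot. *)
split=> [|y]; first by rewrite scheduled_assign sched_i orbT.
case/mem_assign=> // [/done_i //|[eq_ik _]].
by rewrite eq_ik (negPf k_unsched) in sched_i.
Qed.

Lemma reachable_processors S : list_reachable G d S -> respects_processors S.
Proof.
move=> reachS; elim/reachable_ind: S / reachS => [i j x y _|]; first by rewrite ffunE.
move=> S u p k _ IH [[_ avail [k_unsched _]] _] i j x y neq_ij.
case/mem_assign=> // [xS|[eq_ik ->]]; case/mem_assign=> // [yS|[eq_jk ->]].
- exact: IH neq_ij xS yS.
- by move=> xp; left; apply: avail xS xp.
- by move=> /esym yp; right; apply: avail yS yp.
by rewrite eq_ik eq_jk in neq_ij.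
Qed.

(** If [j] precedes [k], readiness at [v] forces [j] to be completed by then; otherwise the
    predecessors of [k] keep the slots they had. *)
Lemma ready_assign S u p j v k : ~~ scheduled S j -> ready G (assign S u p j) v k ->
  ready G S v k \/ u + d j <= v.
Proof.
move=> j_unsched [k_unsched preds].
have [Gjk|notGjk] := boolP (G j k).
  right; have [_ /(_ (p, u, u + d j))] := preds _ Gjk.
  by apply; apply/mem_assign=> //; right.
left; rewrite scheduled_assign negb_or in k_unsched.
split=> [|i Gik]; first by case/andP: k_unsched.
have [sched_i done_i] := preds _ Gik.
have neq_ij : i != j by apply: contraNneq notGjk => <-.
rewrite scheduled_assign (negPf neq_ij) in sched_i; split=> // x xS.
by apply: done_i; apply/mem_assign=> //; left.
Qed.

Lemma available_assign S u p j v q : ~~ scheduled S j ->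
  available (assign S u p j) v q -> available S v q.
Proof.
by move=> j_unsched avail k x xS; apply: (avail k); apply/mem_assign=> //; left.
Qed.

(** The procedure moves forward in time. After [j] starts at [u], a task that can start at [v]
    either was ready at [v] before, and [u] was the earliest choice, or waits for the end of [j]; in
    both cases [u <= v]. *)
Lemma reachable_start_le S v q k i x : list_reachable G d S ->
  can_start G S v q k -> x \in S i -> start x <= v.
Proof.
move=> reachS; elim/reachable_ind: S / reachS v q k i x => [v q k i x _|].
  by rewrite ffunE.
move=> S u p j _ IH [start_j first_j] v q k i x [v_ge0 avail_q ready_k] xS.
have j_unsched : ~~ scheduled S j by case: start_j => _ _ [].
have u_le_v : u <= v.
  have [ready_S|] := ready_assign j_unsched ready_k.
    by apply: (first_j _ q k); split=> //; apply: available_assign avail_q.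
  by apply: le_trans; rewrite lerDl.
apply: le_trans u_le_v; case/mem_assign: xS => // [xS|[_ ->]] //.
exact: IH start_j xS.
Qed.

(** * Greediness: busy and available processors *)

(** The interval is half-open, so that a slot of length 0 keeps no processor busy and the condition
    matches the hypothesis of [interval_covering]. *)
Definition busy S (v : R) p : Prop :=
  exists2 y, y \in slots S & proc y.2 = p /\ start y.2 <= v < stop y.2.

(** When no slot starts after [v], a slot that stops after [v] is running at [v]. *)
Lemma busy_or_available S v p :
  (forall y, y \in slots S -> start y.2 <= v) -> busy S v p \/ available S v p.
Proof.
move=> start_le; have [busy_p|idle_p] := pselect (busy S v p); first by left.
right=> j x xS xp; rewrite leNgt; apply/negP => stop_gt; apply: idle_p.
have xslot : (j, x) \in slots S by rewrite mem_slots.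
by exists (j, x) => //; split=> //; rewrite (start_le (j, x)).
Qed.

Lemma busy_assign S u p j v q : ~~ scheduled S j ->
  busy S v q -> busy (assign S u p j) v q.
Proof.
move=> j_unsched [y yS busy_y]; exists y => //.
by rewrite mem_slots; apply/mem_assign=> //; left; rewrite -mem_slots.
Qed.

(* Greediness: a processor idle at a time when some unscheduled task is ready
   remains idle from then on. *)
Lemma reachable_busy S v q k : list_reachable G d S ->
  0 <= v -> ready G S v k -> busy S v q \/ available S v q.
Proof.
move=> reachS v_ge0; elim/reachable_ind: S / reachS q k => [q k _|].
  by right=> j x; rewrite ffunE.
move=> S u p j reachS IH [start_j first_j] q k ready_k.
have j_unsched : ~~ scheduled S j by case: start_j => _ _ [].
have start_le i x : x \in S i -> start x <= u by apply: reachable_start_le start_j.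
(* If [u <= v], every slot, old or new, has started by [v]. *)
have [u_le_v|v_lt_u] := leP u v.
  apply: busy_or_available => y; rewrite mem_slots.
  case/mem_assign=> // [yS|[_ ->]] //.
  exact: le_trans (start_le _ _ yS) u_le_v.
(* Before [u], task [k] was ready already, and a processor available at [v] would have allowed a
   start earlier than [u]. *)
have ready_S : ready G S v k.
  have [//|] := ready_assign j_unsched ready_k.
  by move=> u_d; have := d_ge0 j; lra.
have [busy_q|avail_q] := IH q k ready_S; first by left; apply: busy_assign.
by have := first_j v q k; rewrite leNgt v_lt_u => /(_ (And3 v_ge0 avail_q ready_S)).
Qed.

(** * Work and idle time *)

Definition work S (v : R) : R :=
  \sum_(y <- slots S) elapsed (start y.2) (stop y.2) v.

Hypothesis m_gt0 : (0 < m)%N.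

Lemma reachable_start_stop S y : list_reachable G d S -> y \in slots S ->
  start y.2 <= stop y.2.
Proof.
move=> reachS; rewrite mem_slots => /(reachable_slot reachS)[_ _ ->].
by rewrite lerDl.
Qed.

Lemma work_homo S v w : list_reachable G d S -> v <= w -> work S v <= work S w.
Proof.
move=> reachS vw; rewrite /work [leLHS]big_seq [leRHS]big_seq; apply: ler_sum => y yS.
by apply: elapsed_homo => //; exact: reachable_start_stop yS.
Qed.

(** During the run of [x], its own term grows by [d j] and no other term decreases; hence the idle
    time grows by at most [(m - 1) * d j]. *)
Lemma work_slot S j x : list_reachable G d S -> x \in S j ->
  work S (start x) + d j <= work S (stop x).
Proof.
move=> reachS xS; have xslot : (j, x) \in slots S by rewrite mem_slots.
have [_ _ stop_x] := reachable_slot reachS xS.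
have start_stop : start x <= stop x := reachable_start_stop reachS xslot.
rewrite /work !(big_rem _ xslot) /= elapsed_start // elapsed_stop //.
rewrite add0r addrC lerD //; last by rewrite stop_x addrC addKr.
rewrite [leLHS]big_seq [leRHS]big_seq; apply: ler_sum => y /mem_rem yS.
by apply: elapsed_homo => //; exact: reachable_start_stop yS.
Qed.

(** On each processor the slots cover the whole window, so [interval_covering] applies to each
    separately. *)
Lemma work_busy S v w : list_reachable G d S -> v <= w ->
  (forall u p, v <= u < w -> busy S u p) -> m%:R * (w - v) <= work S w - work S v.
Proof.
move=> reachS vw busy_vw; rewrite /work -sumrB.
rewrite (partition_big (fun y => proc y.2) xpredT) //=.
have -> : m%:R * (w - v) = \sum_(p < m) (w - v).
  by rewrite sumr_const card_ord mulr_natl.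
apply: ler_sum => p _; rewrite -big_filter.
apply: (@interval_covering _ _ (fun y => start y.2) (fun y => stop y.2)) => //.
  by move=> y; rewrite mem_filter => /andP[_]; apply: reachable_start_stop.
move=> u /busy_vw => /(_ p)[y yS [yp y_busy]].
by exists y => //; rewrite mem_filter yp eqxx.
Qed.

(** Thanks to this, an upper bound on the idle time survives later assignments. *)
Lemma work_assign S u p j v : list_reachable G d S -> ~~ scheduled S j ->
  work S v <= work (assign S u p j) v.
Proof.
move=> reachS j_unsched; rewrite /work !big_slots; apply: ler_sum => k _ /=.
rewrite ffunE; case: eqP => // ->.
move: j_unsched; rewrite /scheduled negbK => /eqP ->.
rewrite big_seq_fset0 big_seq_fset1; apply: elapsed_ge0.
by rewrite lerDl.
Qed.

Lemma work_le S v : list_reachable G d S -> work S v <= \sum_j d j.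
Proof.
move=> reachS; rewrite /work big_slots; apply: ler_sum => j _ /=.
have [/scheduledP[x xS]|/negPn/eqP ->] := boolP (scheduled S j); last by rewrite big_seq_fset0.
have [-> _ stop_x] := reachable_slot reachS xS.
rewrite big_seq_fset1; apply: le_trans (elapsed_le _ _) _; rewrite stop_x.
  by rewrite lerDl.
by rewrite addrC addKr.
Qed.

(** The default 0 is the earliest time at which any task may start. *)
Definition latest_stop S (Q : pred (J * slot R m)) : R :=
  \big[Num.max/0]_(y <- slots S | Q y) stop y.2.

Lemma latest_stop_le S (Q : pred (J * slot R m)) v : 0 <= v ->
  latest_stop S Q <= v <-> forall k x, x \in S k -> Q (k, x) -> stop x <= v.
Proof.
move=> v_ge0; split=> [latest_v k x xS Qx|stop_v].
  apply: le_trans latest_v; have xslot : (k, x) \in slots S by rewrite mem_slots.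
  exact: (bigmax_sup_seq _ _ _ _ _ xslot Qx).
rewrite /latest_stop big_seq_cond; apply: bigmax_le => // y /andP[].
by rewrite mem_slots => yS Qy; apply: (stop_v y.1); case: y yS Qy.
Qed.

Lemma latest_stop_attained S (Q : pred (J * slot R m)) : latest_stop S Q = 0 \/
  exists k x, [/\ x \in S k, Q (k, x) & latest_stop S Q = stop x].
Proof.
pose K z := z = 0 \/ exists k x, [/\ x \in S k, Q (k, x) & z = stop x].
rewrite -/(K _) /latest_stop big_seq_cond; apply: big_ind; first by left.
  by move=> a b; case: leP.
move=> [k x]; rewrite mem_slots => /andP[xS Qx]; right; by exists k, x.
Qed.

(* [m * v - work S v] is the total idle time before [v]. It does not grow while
   a ready task waits, and grows at rate at most [m - 1] while some task runs. *)
Lemma reachable_idle (t : J -> R) S j x : (forall j, 0 <= t j) ->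
  (forall i j, G i j -> t i + d i <= t j) ->
  list_reachable G d S -> x \in S j ->
  m%:R * start x - work S (start x) <= (m%:R - 1) * t j.
Proof.
move=> t_ge0 t_prec reachS.
elim/reachable_ind: S / reachS j x => [j x|]; first by rewrite ffunE.
move=> S u p j reachS IH [start_j first_j] k x.
have [u_ge0 _ [j_unsched preds]] := start_j.
have work_le v := work_assign u p v reachS j_unsched.
have m_ge1 : 0 <= m%:R - 1 :> R by rewrite subr_ge0 ler1n.
case/mem_assign=> // [xS|[-> ->]].
  by apply: le_trans (IH _ _ xS); rewrite lerD2l lerN2.
rewrite [start _]/=.
apply: le_trans (_ : m%:R * u - work S u <= _); first by rewrite lerD2l lerN2.
(* The time at which [j] becomes ready: the end of its last-finishing predecessor, or 0. *)
pose r := latest_stop S (fun y => G y.1 j).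
have r_ge0 : 0 <= r by exact: bigmax_ge_id.
have r_le_u : r <= u.
  by apply/latest_stop_le => // i y yS /preds[_]; apply.
(* Between [r] and [u] task [j] is ready, so an available processor would have given a start before
   [u]; by greediness every processor is busy. *)
have busy_ru v q : r <= v < u -> busy S v q.
  move=> /andP[r_v v_u]; have v_ge0 := le_trans r_ge0 r_v.
  have ready_v : ready G S v j.
    split=> // i Gij; have [sched_i _] := preds _ Gij; split=> //.
    by move=> y yS; apply: (proj1 (latest_stop_le _ _ v_ge0) r_v) yS Gij.
  have [//|avail_q] := reachable_busy q reachS v_ge0 ready_v.
  have := first_j v q j (And3 v_ge0 avail_q ready_v).
  by rewrite leNgt v_u.
have work_ru := work_busy reachS r_le_u busy_ru.
rewrite /r in work_ru.
suff : m%:R * r - work S r <= (m%:R - 1) * t j by rewrite /r; lra.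
(* If [r] is 0, there is no idle time yet. Otherwise the induction hypothesis bounds the idle time
   before the start of a predecessor [i], its run adds at most [(m - 1) * d i], and
   [t i + d i <= t j]. *)
rewrite /r; have [->|[i [y [yS Gij ->]]]] := latest_stop_attained S (fun y => G y.1 j).
  have work0 : 0 <= work S 0.
    rewrite /work big_seq; apply: sumr_ge0 => y yS.
    by apply: elapsed_ge0; exact: reachable_start_stop yS.
  by have := mulr_ge0 m_ge1 (t_ge0 j); lra.
have := work_slot reachS yS; have := IH _ _ yS.
have [_ _ ->] := reachable_slot reachS yS.
by have := ler_wpM2l m_ge1 (t_prec _ _ Gij); lra.
Qed.

(** * Makespan bound and feasibility of list schedules *)

Lemma list_schedule_makespan (mu : R) (t : J -> R) S :
  0 <= mu -> (forall j, 0 <= t j) ->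
  (forall i j, G i j -> t i + d i <= t j) -> (forall j, t j + d j <= mu) ->
  m%:R^-1 * \sum_j d j <= mu ->
  list_reachable G d S -> makespan S <= (2 - 1 / m%:R) * mu.
Proof.
move=> mu_ge0 t_ge0 t_prec t_mu load_mu reachS.
have m_ge1 : 0 <= m%:R - 1 :> R by rewrite subr_ge0 ler1n.
have mR_gt0 : 0 < m%:R :> R by rewrite ltr0n.
have factor_ge0 : 0 <= 2 - 1 / m%:R :> R.
  by rewrite subr_ge0 ler_pdivrMr //; lra.
(* [makespan] is a maximum with default 0, so the bound itself must be nonnegative. *)
have bound_ge0 := mulr_ge0 factor_ge0 mu_ge0.
apply: bigmax_le => // j _; rewrite big_seq; apply: bigmax_le => // x xS.
have [_ _ stop_x] := reachable_slot reachS xS.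
have load : \sum_j d j <= m%:R * mu by rewrite -ler_pdivrMl.
(* [idle], [run] and [path] bound the idle time before [stop x] by [(m - 1) * mu], while [total] and
   [load] bound the work by [m * mu]; the sum is [(2 * m - 1) * mu]. *)
have idle := reachable_idle t_ge0 t_prec reachS xS.
have path := ler_wpM2l m_ge1 (t_mu j).
have run := work_slot reachS xS.
have total := work_le (stop x) reachS.
rewrite -(ler_pM2l mR_gt0) mulrA mulrBr mul1r mulfV ?gt_eqF //.
rewrite stop_x in run total *; lra.
Qed.

Lemma list_schedule_feasible e E S : \sum_(j : J) e j (d j) <= E ->
  list_schedule G d S -> feasible G e E S.
Proof.
move=> energy [reachS all_sched]; split.
- split=> [j|j x y xS yS neq_xy].
    split=> [|x xS]; first by apply/eqP; exact: all_sched.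
    by have [_ -> ->] := reachable_slot reachS xS; rewrite lerDl /=.
  have [Sj _ _] := reachable_slot reachS xS.
  by rewrite Sj inE in yS; case: neq_xy; apply/esym/eqP.
- move=> i j x y Gij xS yS.
  by have [_] := reachable_precedence reachS Gij yS; apply.
- exact: reachable_processors.
rewrite (eq_bigr (fun j => e j (d j))) // => j _; congr (e j _).
have /scheduledP[x xS] := all_sched j.
have [Sj _ stop_x] := reachable_slot reachS xS.
by rewrite /duration Sj big_seq_fset1 stop_x addrC addKr.
Qed.

(** * Existence of a list schedule *)

(** Take [j] in [P] with the fewest ancestors. A predecessor [i] in [P] would have strictly fewer:
    [j] is its own ancestor, and being one of [i] would close a cycle. *)
Lemma acyclic_source (P : pred J) j0 : acyclic G -> P j0 ->
  exists2 j, P j & forall i, G i j -> ~~ P i.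
Proof.
move=> acyclicG Pj0; pose ancestors j := [pred i | connect G i j].
case: (arg_minnP (fun j => #|ancestors j|) Pj0) => j Pj min_j.
exists j => // i Gij; apply/negP => /min_j; apply/negP; rewrite -ltnNge.
apply: proper_card; apply/properP; split.
  apply/fintype.subsetP => k; rewrite !inE => k_i.
  exact: connect_trans k_i (connect1 Gij).
exists j; rewrite !inE ?connect0 //; apply/negP => /connectP[c path_c last_c].
by have := acyclicG (j :: c); rewrite /= rcons_path path_c -last_c => /(_ Gij).
Qed.

(** A candidate is a processor with an unscheduled task whose predecessors are all scheduled; it can
    start exactly from its time [T] on. Candidates are finite in number, so one of them has the
    least [T]. *)
Lemma exists_list_step S : acyclic G -> ~ (forall j, scheduled S j) ->
  exists u p j, earliest_start S u p j.
Proof.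
move=> acyclicG not_all.
have [j0 j0_unsched] : exists j, ~~ scheduled S j.
  by apply/existsP; rewrite -negb_forall; apply/forallP.
have [j1 j1_unsched j1_preds] :=
  acyclic_source (P := fun j => ~~ scheduled S j) acyclicG j0_unsched.
pose Q (c : 'I_m * J) := ~~ scheduled S c.2 && [forall i, G i c.2 ==> scheduled S i].
pose T (c : 'I_m * J) :=
  latest_stop S (fun y => (proc y.2 == c.1) || G y.1 c.2).
(* A candidate exists: acyclicity provides the task and [m_gt0] the processor. *)
have Q1 : Q (Ordinal m_gt0, j1).
  rewrite /Q /= j1_unsched; apply/forallP => i; apply/implyP => /j1_preds.
  by rewrite negbK.
have can_startP u p j : can_start G S u p j <-> [/\ 0 <= u, Q (p, j) & T (p, j) <= u].
  split=> [[u_ge0 avail [j_unsched preds]]|[u_ge0 /andP[j_unsched preds] T_u]].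
    split=> //.
      rewrite /Q /= j_unsched; apply/forallP => i; apply/implyP => /preds.
      by case.
    apply/latest_stop_le => // k x xS /= /orP[/eqP|/preds[_]]; last exact.
    exact: avail xS.
  have stop_u := proj1 (latest_stop_le _ _ u_ge0) T_u.
  split=> // [k x xS xp|]; first by apply: stop_u xS _; rewrite /= xp eqxx.
  split=> // i Gij; split; first by have /forallP/(_ i) := preds; rewrite Gij.
  by move=> x xS; apply: stop_u xS _; rewrite /= Gij orbT.
case: (arg_minP T Q1) => [[p j] Qpj min_pj].
have T_ge0 c : 0 <= T c by exact: bigmax_ge_id.
exists (T (p, j)), p, j; split; first by apply/can_startP.
by move=> u' p' j' /can_startP[_ /min_pj T_le]; apply: le_trans.
Qed.

(** Induction on the number of unscheduled tasks, generalized over the current state: each step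
    schedules one more. *)
Lemma exists_list_schedule : acyclic G ->
  exists S, list_schedule G d S.
Proof.
move=> acyclicG.
suff extend n S : list_reachable G d S ->
    (#|[pred j | ~~ scheduled S j]| <= n)%N -> exists S', list_schedule G d S'.
  exact: extend (list_init _ _ _) (leqnn _).
elim: n S => [|n IHn] S reachS size_unsched.
  exists S; split=> // j; move: size_unsched; rewrite leqn0 => /eqP/card0_eq/(_ j).
  by rewrite inE => /negbFE.
have [all_sched|not_all] := pselect (forall j, scheduled S j); first by exists S.
have [u [p [j [start_j first_j]]]] := exists_list_step acyclicG not_all.
apply: (IHn (assign S u p j)).
  by apply: list_next reachS _; exists u, p, j.
have j_unsched : ~~ scheduled S j by case: start_j => _ _ [].
rewrite -ltnS; apply: leq_trans size_unsched; apply: proper_card.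
apply/properP; split.
  apply/fintype.subsetP => k; rewrite !inE scheduled_assign negb_or => /andP[_ ->//].
by exists j; rewrite !inE // scheduled_assign eqxx.
Qed.

End ListScheduling.

(** * The approximation ratio against the optimal makespan *)

Theorem theorem2 (R : realType) (J : finType) (m : nat) (hm : (1 <= m)%N)
    (G : rel J) (hG : acyclic G)
    (e : J -> R -> R) (he : forall j : J, energy_function (e j))
    (E : R) (hE : 0 <= E)
    (mu1 : R) (t d : J -> R) (hopt : P1_optimal m G e E mu1 t d) :
  (exists S2 : schedule R J m, list_schedule G d S2) /\
  (forall S2 : schedule R J m, list_schedule G d S2 ->
    [/\ feasible G e E S2,
        no_preemption_or_migration S2
      & makespan S2 <= (2 - 1 / m%:R) * optimal_makespan m G e E]).
Proof.
have [[[mu_ge0 t_ge0 d_ge0] t_prec t_mu energy load] _] := hopt.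
split=> [|S2 list_S2]; first exact: exists_list_schedule.
have feasible_S2 := list_schedule_feasible d_ge0 energy list_S2.
have [reach_S2 all_sched] := list_S2.
split=> // [j|].
  have /scheduledP[x xS2] := all_sched j; exists x.
  by have [] := reachable_slot reach_S2 xS2.
apply: le_trans (list_schedule_makespan d_ge0 hm mu_ge0 t_ge0 t_prec t_mu load reach_S2) _.
(* The ratio is nonnegative, so [mu1] may be replaced by the optimal makespan; [S2] itself shows
   that a feasible schedule exists. *)
apply: ler_wpM2l; last by apply: P1_optimal_le hm hopt _; exists S2.
rewrite subr_ge0 ler_pdivrMr ?ltr0n //.
have : 1 <= m%:R :> R by rewrite ler1n.
lra.
Qed.
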